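(* Let $D$ be a dendrite and let $f\colon D\to D$ be a transitive continuous map. If there is a point $q\in D\setminus \mathrm{End}(D)$ whose orbit is dense in $D$, then there is a terminal decomposition for $(D,f)$.
   Context: A continuum is a compact, connected, nonempty metric space. A dendrite is a continuum $D$ in which any two distinct points can be separated by a third point of $D$. A point of $D$ is an endpoint if it has order $1$, i.e. it has arbitrarily small open neighborhoods with one-point boundary; $\mathrm{End}(D)$ is the set of endpoints. The orbit of $x$ is $\{f^n(x):n\in\mathbb{N}\}$. A continuous map $f\colon X\to X$ of a compact metric space is transitive if for all nonempty open $U,V\subset X$ there is $n>0$ with $f^n(U)\cap V\neq\emptyset$. A set is regular closed if it is the closure of its interior. A regular periodic decomposition of length $m$ for $(X,f)$ is a finite sequence $(D_0,\dots,D_{m-1})$ of subsets of $X$ such that: (1) it is a cover of $X$ consisting of regular closed sets; (2) $f(D_i)=D_{i+1\ (\mathrm{mod}\ m)}$ for $i=0,\dots,m-1$; (3) $D_i\cap D_j$ is nowhere dense in $X$ for $i\ne j$. A regular periodic decomposition is terminal if it is of maximal length among the regular periodic decompositions of $(X,f)$. *)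

(* Defs.v *)
From mathcomp Require Import all_boot all_order all_algebra.
From mathcomp Require Import all_classical all_reals all_analysis.

Set Implicit Arguments.
Unset Strict Implicit.
Unset Printing Implicit Defensive.

Local Open Scope classical_set_scope.

Definition nowhere_dense (T : topologicalType) (A : set T) : Prop :=
  interior (closure A) = set0.

Definition topological_boundary (T : topologicalType) (A : set T) : set T :=
  closure A `\` interior A.

Definition continuum (R : realType) (D : metricType R) : Prop :=
  [/\ [set: D] !=set0, compact [set: D] & connected [set: D]].

(* [z] separates [x] and [y]: the complement of [z] splits into two separated
   sets, one containing [x] and the other [y]; in particular [z <> x, y]. *)
Definition separates_points (T : topologicalType) (z x y : T) : Prop :=
  exists A B : set T,
    [/\ ~` [set z] = A `|` B, separated A B, A x & B y].

Definition dendrite (R : realType) (D : metricType R) : Prop :=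
  continuum D /\
  forall x y : D, x <> y -> exists z : D, separates_points z x y.

Definition endpoint (T : topologicalType) (x : T) : Prop :=
  forall U : set T, nbhs x U ->
    exists V : set T, [/\ open V, V x, V `<=` U &
      exists b : T, topological_boundary V = [set b]].

Definition Endpoints (T : topologicalType) : set T := [set x | endpoint x].
Arguments Endpoints T : clear implicits.

(* The orbit contains [x] itself (n = 0). *)
Definition forward_orbit (T : Type) (f : T -> T) (x : T) : set T :=
  range (fun n : nat => iter n f x).

Definition transitive_map (T : topologicalType) (f : T -> T) : Prop :=
  forall U V : set T, open U -> open V -> U !=set0 -> V !=set0 ->
    exists2 n : nat, (0 < n)%N & (iter n f @` U) `&` V !=set0.

(* [ordS i] is the successor of [i : 'I_m] modulo [m].  No positivity of [m] is
   required: on a nonempty space the covering condition excludes [m = 0]. *)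
Definition regular_periodic_decomposition (T : topologicalType) (f : T -> T)
    (m : nat) (C : 'I_m -> set T) : Prop :=
  [/\ \bigcup_(i in [set: 'I_m]) C i = [set: T],
      forall i, regclosed (C i),
      forall i, f @` C i = C (ordS i) &
      forall i j, i <> j -> nowhere_dense (C i `&` C j)].

Definition terminal_decomposition (T : topologicalType) (f : T -> T)
    (m : nat) (C : 'I_m -> set T) : Prop :=
  regular_periodic_decomposition f C /\
  forall (k : nat) (C' : 'I_k -> set T),
    regular_periodic_decomposition f C' -> (k <= m)%N.

(* Main.v *)
Require Import Defs.
From mathcomp Require Import all_boot all_order all_algebra.
From mathcomp Require Import all_classical all_reals all_analysis.

Local Open Scope classical_set_scope.

(* A non-endpoint [q] cuts [D] into nonempty open sets [A] and [B], which the
   orbit of [q] visits at times [a] and [b]; every regular periodic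
   decomposition then has length [m <= maxn a b]. Otherwise, let [K] be the
   component of [q] in its piece. For some multiple [N > 0] of [m],
   [f^N(K)] is contained in [K], and [D] is the union of the continua
   [K_i = f^i(K)], [i < N]. As [q] lies in a single piece, [K_a] and [K_b] avoid
   [q], so [K_a] is contained in [A] and [K_b] in [B], and they are disjoint.
   But all the [K_i] meet each other: like every finite family of subtrees of a
   tree, they have a member whose neighbours in the intersection graph pairwise
   meet, the cyclic symmetry gives this property to every member, so adjacency
   is transitive, and [D] is connected. *)

(* The complements in [L] of the sets satisfying [P] would form a proper filter. *)
Lemma compact_ideal {T : topologicalType} (P : set T -> Prop) (L : set T) :
  compact L -> P set0 ->
  (forall X Y, X `<=` Y -> P Y -> P X) ->
  (forall X Y, P X -> P Y -> P (X `|` Y)) ->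
  (forall x, L x -> exists2 U, nbhs x U & P U) -> P L.
Proof.
move=> cL P0 Psub PU Ploc; apply: contrapT => nPL.
pose F : set_system T := [set X | P (L `\` X)].
have FF : ProperFilter F.
  apply: Build_ProperFilter_ex.
    move=> X FX; apply: contrapT => X0; apply: nPL; apply: Psub FX.
    by move=> x Lx; split => // Xx; apply: X0; exists x.
  split; first by apply: Psub P0; rewrite setDT.
    by move=> X Y FX FY; rewrite /F/= setDIr; exact: PU.
  by move=> X Y XY; apply: Psub; exact: setDS.
have FL : F L by rewrite /F/= setDv.
have [x [Lx Fx]] := cL F FF FL.
have [U Ux PUU] := Ploc x Lx.
have FU : F (~` U).
  by apply: Psub PUU => y [_ /contrapT].
by have [y [nUy Uy]] := Fx _ _ FU Ux.
Qed.

(** * Cuts of a space at a point *)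

Definition cut {T : topologicalType} (z : T) (A B : set T) : Prop :=
  [/\ open A, open B, A `&` B = set0 & A `|` B = ~` [set z]].

Lemma cutC {T : topologicalType} (z : T) (A B : set T) : cut z A B -> cut z B A.
Proof. by move=> [oA oB AB0 ABz]; split; rewrite // (setIC, setUC). Qed.

Lemma cut_separated {T : topologicalType} {z : T} {A B : set T} :
  cut z A B -> separated A B.
Proof.
move=> [oA oB AB0 _]; split; rewrite -subset0 => x [] + +.
  move=> /[swap] Bx /(_ B (open_nbhs_nbhs (conj oB Bx))) [y].
  by rewrite AB0.
move=> Ax /(_ A (open_nbhs_nbhs (conj oA Ax))) [y].
by rewrite setIC AB0.
Qed.

Lemma open_separatedUl {T : topologicalType} {A B : set T} :
  open (A `|` B) -> separated A B -> open A.
Proof.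
move=> oAB [_ AB0].
rewrite (_ : A = (A `|` B) `&` ~` closure B).
  by apply: openI => //; exact/closed_openC/closed_closure.
apply/seteqP; split=> [x Ax|x [[//|Bx] /(_ (subset_closure Bx))//]].
by split; [left|move=> cBx; have : set0 x by rewrite -AB0].
Qed.

Lemma separated_cut {T : topologicalType} {z : T} {A B : set T} :
  closed [set z] -> ~` [set z] = A `|` B -> separated A B -> cut z A B.
Proof.
move=> cz zAB AB.
have oAB : open (A `|` B) by rewrite -zAB; exact: closed_openC.
split=> //; first exact: open_separatedUl oAB AB.
  by apply: (@open_separatedUl _ B A); [rewrite setUC|rewrite separatedC].
rewrite -subset0 => x [Ax Bx]; rewrite -AB.1; split=> //.
exact: subset_closure.
Qed.

Lemma cut_memP {T : topologicalType} {z : T} {A B : set T} (x : T) :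
  cut z A B -> x <> z -> A x \/ B x.
Proof. by move=> [_ _ _ zAB] xz; have : (A `|` B) x by rewrite zAB. Qed.

Lemma cut_neql {T : topologicalType} {z : T} {A B : set T} (x : T) :
  cut z A B -> A x -> x <> z.
Proof. by move=> [_ _ _ zAB] Ax; have : (~` [set z]) x by rewrite -zAB; left. Qed.

Lemma cut_disj {T : topologicalType} {z : T} {A B : set T} (x : T) :
  cut z A B -> A x -> B x -> False.
Proof. by move=> [_ _ AB0 _] Ax Bx; have : set0 x by rewrite -AB0. Qed.

Lemma connected_notin_cut {T : topologicalType} {z : T} {A B X : set T} :
  cut z A B -> connected X -> ~ X z -> X `<=` A \/ X `<=` B.
Proof.
move=> cz cX nXz; apply: connected_subset (cut_separated cz) _ cX => x Xx.
by apply: (cut_memP x cz) => xz; apply: nXz; rewrite -xz.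
Qed.

Lemma connected_sub_cutl {T : topologicalType} {z : T} {A B X : set T} (x : T) :
  cut z A B -> connected X -> ~ X z -> X x -> A x -> X `<=` A.
Proof.
move=> cz cX nXz Xx Ax; have [//|XB] := connected_notin_cut cz cX nXz.
by have := cut_disj x cz Ax (XB _ Xx).
Qed.

(* A separation of [X `&` (A `|` [set z])] whose first part contains [z] becomes a
   separation of [X] once [X `&` B] is added to that part. *)
Lemma connected_cut_side {T : topologicalType} {z : T} {A B X : set T} :
  cut z A B -> connected X -> X z -> connected (X `&` (A `|` [set z])).
Proof.
move=> cz cX Xz; apply/connectedP => E [E0 defX sepE].
wlog Ez : E E0 defX sepE / E false z.
  move=> wl; have : (E false `|` E true) z by rewrite -defX; split=> //; right.
  move=> [|Ez]; first exact: wl.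
  apply: (wl (E \o negb)) => //=.
    by rewrite defX setUC.
  by rewrite separatedC.
have E1A : E true `<=` A.
  move=> x E1x; have : (X `&` (A `|` [set z])) x by rewrite defX; right.
  move=> [_ [//|/= xz]]; have : set0 x; last by [].
  by rewrite -sepE.1; split=> //; apply: subset_closure; rewrite xz.
have [sAB1 sAB2] := cut_separated cz.
apply: (connectedP X).1 cX (fun b => if b then E true else E false `|` (X `&` B)) _.
split.
- by case=> //; have [x Ex] := E0 false; exists x; left.
- apply/seteqP; split=> x.
    move=> Xx; have [xz|xz] := pselect (x = z); first by left; left; rewrite xz.
    have [Ax|Bx] := cut_memP x cz xz; last by left; right.
    have : (X `&` (A `|` [set z])) x by split=> //; left.
    by rewrite defX => -[]; [left; left|right].
  have EX b : E b `<=` X.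
    move=> y Ey; have : (X `&` (A `|` [set z])) y.
      by rewrite defX; case: b Ey; [right|left].
    by case.
  by move=> [[/EX//|[]//]|/EX].
- split.
    rewrite closureU setIUl sepE.1 set0U -subset0 => x [+ /E1A Ax].
    move=> /(closure_subset (@subIsetr _ _ _)) cBx.
    by rewrite -sAB2.
  rewrite setIUl sepE.2 set0U -subset0 => x [[_ Bx] /(closure_subset E1A) cAx].
  by rewrite -sAB1.
Qed.

Lemma connected_setI_cut {T : topologicalType} {z : T} {A B X : set T} (x : T) :
  cut z A B -> connected X -> X x -> A x -> connected (X `&` (A `|` [set z])).
Proof.
move=> cz cX Xx Ax; have [Xz|nXz] := pselect (X z).
  exact: connected_cut_side cz cX Xz.
rewrite setIidl// => y Xy; left.
exact: connected_sub_cutl cz cX nXz Xx Ax y Xy.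
Qed.

Lemma cut_side_connected {T : topologicalType} {z : T} {A B : set T} :
  connected [set: T] -> cut z A B -> connected (A `|` [set z]).
Proof. by move=> cT cz; rewrite -[X in connected X]setTI; exact: connected_cut_side cz cT I. Qed.

(** The connected set [A]|[[set z]] misses [z'] and meets [A'], so it lies in [A']. Hence [B']
    avoids it, which leaves only [B]. *)
Lemma cut_nested {T : topologicalType} {z z' : T} {A B A' B' : set T} (x : T) :
  connected [set: T] -> cut z A B -> cut z' A' B' ->
  B z' -> A x -> A' x -> B' `<=` B.
Proof.
move=> cT cz cz' Bz' Ax A'x.
have sub : A `|` [set z] `<=` A'.
  apply: connected_sub_cutl cz' (cut_side_connected cT cz) _ (or_introl Ax) A'x.
  move=> [Az'|/= z'z]; first exact: (cut_disj z' cz Az' Bz').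
  exact: (cut_neql z' (cutC _ _ _ cz) Bz').
move=> y B'y; have [yz|yz] := pselect (y = z).
  by case: (cut_disj y cz' _ B'y); apply: sub; right.
have [Ay|//] := cut_memP y cz yz.
by case: (cut_disj y cz' _ B'y); apply: sub; left.
Qed.

(** * Separating continua by a single point *)

(** If [z' = z], intersect the sides around [S] and unite the others. Otherwise one of the two cuts
    already works: [z'] in [A] forces [B] into [B'], and [z'] in [B] forces [B'] into [B]. *)
Lemma cut_merge {T : topologicalType} {z z' : T} {S A B A' B' : set T} :
  connected [set: T] -> S !=set0 -> cut z A B -> cut z' A' B' ->
  S `<=` A -> S `<=` A' -> B `&` B' !=set0 ->
  exists w A1 B1, [/\ cut w A1 B1, S `<=` A1 & B `|` B' `<=` B1].
Proof.
move=> cT [s Ss] cz cz' SA SA' [y [By B'y]].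
have [z'z|z'z] := pselect (z' = z).
  rewrite {z'}z'z in cz'; case: (cz) (cz') => oA oB AB0 ABz [oA' oB' AB0' ABz'].
  exists z, (A `&` A'), (B `|` B'); split=> //; last first.
    by move=> x Sx; split; [exact: SA|exact: SA'].
  split; [exact: openI|exact: openU| |].
    rewrite -subset0 => x [[Ax A'x] [Bx|B'x]].
      exact: (cut_disj x cz).
    exact: (cut_disj x cz').
  apply/seteqP; split=> x.
    move=> [[Ax _]|[Bx|B'x]]; first exact: (cut_neql x cz).
      exact: (cut_neql x (cutC _ _ _ cz)).
    exact: (cut_neql x (cutC _ _ _ cz')).
  move=> xz; have [Ax|Bx] := cut_memP x cz xz; last by right; left.
  by have [A'x|B'x] := cut_memP x cz' xz; [left|right; right].
have [Az'|Bz'] := cut_memP z' cz z'z.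
  have BB' : B `<=` B'.
    have nz' : ~ (B `|` [set z]) z'.
      by move=> [Bz'|//]; exact: (cut_disj z' cz).
    have := connected_sub_cutl y (cutC _ _ _ cz')
      (cut_side_connected cT (cutC _ _ _ cz)) nz' (or_introl By) B'y.
    by move=> sub x Bx; apply: sub; left.
  by exists z', A', B'; split=> // x [/BB'|].
exists z, A, B; split=> // x [//|].
exact: (cut_nested s cT cz cz' Bz' (SA _ Ss) (SA' _ Ss)).
Qed.

(** The points that one cut separates from [S] together with a fixed [y0] form a set [Q], open and,
    by merging cuts, relatively closed in [M]; so [Q] contains [M]. All sides used contain [y0],
    hence overlap, and finitely many covering [L] merge into one. *)
Lemma cut_compact {T : topologicalType} {S M L : set T} :
  connected [set: T] -> S !=set0 -> connected M -> M !=set0 ->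
  (forall y, M y -> exists z A B, [/\ cut z A B, S `<=` A & B y]) ->
  compact L -> L `<=` M ->
  exists z A B, [/\ cut z A B, S `<=` A & L `<=` B].
Proof.
move=> cT S0 cM [y0 My0] Mcut cL LM.
pose Q y := exists z A B, [/\ cut z A B, S `<=` A, B y0 & B y].
have MQ : M `<=` Q.
  have oQ : open Q.
    rewrite openE => y [z [A [B [cz SA By0 By]]]].
    have [_ oB _ _] := cz.
    apply: filterS (open_nbhs_nbhs (conj oB By)) => x Bx.
    by exists z, A, B.
  have oQ' : open [set y | exists z A B, [/\ cut z A B, S `<=` A, B y & B `&` Q = set0]].
    rewrite openE => y [z [A [B [cz SA By BQ]]]].
    have [_ oB _ _] := cz.
    apply: filterS (open_nbhs_nbhs (conj oB By)) => x Bx.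
    by exists z, A, B.
  (* If the side containing [y] met [Q], merging the two cuts at a common point would put [y] in
     [Q]. *)
  have Qsep y : M y -> ~ Q y ->
      exists z A B, [/\ cut z A B, S `<=` A, B y & B `&` Q = set0].
    move=> My nQy; have [z [A [B [cz SA By]]]] := Mcut y My.
    exists z, A, B; split=> //; rewrite -subset0 => x [Bx [z' [A' [B' [cz' SA' B'y0 B'x]]]]].
    have [|w [A1 [B1 [cw SA1 B1s]]]] := cut_merge cT S0 cz cz' SA SA'.
      by exists x.
    by apply: nQy; exists w, A1, B1; split=> //; apply: B1s; [right|left].
  have <- : M `&` Q = M; last by move=> x [].
  apply: cM; first last.
  - exists (~` [set y | exists z A B, [/\ cut z A B, S `<=` A, B y & B `&` Q = set0]]).
      exact: open_closedC.
    apply/seteqP; split=> y [My].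
      move=> Qy; split=> // -[z [A [B [_ _ By BQ]]]].
      by have : set0 y by rewrite -BQ.
    move=> nQy; split=> //; apply: contrapT => /(Qsep y My).
    exact: nQy.
  - by exists Q.
  - exists y0; split=> //; have [z [A [B [cz SA By]]]] := Mcut _ My0.
    by exists z, A, B.
suff [z [A [B [cz SA _ LB]]]] :
    exists z A B, [/\ cut z A B, S `<=` A, B y0 & L `<=` B].
  by exists z, A, B.
apply: (compact_ideal (fun X => exists z A B, [/\ cut z A B, S `<=` A, B y0 & X `<=` B])) cL _ _ _ _.
- have [z [A [B [cz SA By]]]] := Mcut _ My0.
  by exists z, A, B; split.
- move=> X Y XY [z [A [B [cz SA By YB]]]].
  by exists z, A, B; split=> //; exact: subset_trans YB.
- move=> X Y [z [A [B [cz SA By YB]]]] [z' [A' [B' [cz' SA' B'y YB']]]].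
  have [|w [A1 [B1 [cw SA1 B1s]]]] := cut_merge cT S0 cz cz' SA SA'.
    by exists y0.
  exists w, A1, B1; split=> //; first by apply: B1s; left.
  by move=> x [/YB Bx|/YB' B'x]; apply: B1s; [left|right].
- move=> x /LM/MQ [z [A [B [cz SA By0 Bx]]]].
  have [_ oB _ _] := cz.
  exists B; first exact: open_nbhs_nbhs.
  by exists z, A, B; split.
Qed.

Definition cut_points {T : topologicalType} : Prop :=
  forall x y : T, x <> y -> exists z A B, [/\ cut z A B, A x & B y].

(** Two passes of [cut_compact]: first each point of [K] is cut from all of [L], then [L] is cut
    from all of [K]. *)
Lemma cut_disjoint_continua {T : topologicalType} {K L : set T} :
  @cut_points T -> connected [set: T] ->
  connected K -> compact K -> K !=set0 -> connected L -> compact L -> L !=set0 ->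
  K `&` L = set0 -> exists z A B, [/\ cut z A B, K `<=` A & L `<=` B].
Proof.
move=> hT cT cK kK K0 cL kL L0 KL0.
suff [z [A [B [cz LA KB]]]] : exists z A B, [/\ cut z A B, L `<=` A & K `<=` B].
  by exists z, B, A; split=> //; exact: cutC.
apply: (cut_compact cT L0 cK K0 _ kK) => // x Kx.
have [|z [A [B [cz xA LB]]]] := cut_compact cT (ex_intro [set x] x erefl) cL L0 _ kL (@subset_refl _ L).
  move=> y Ly; have xy : x <> y.
    by move=> xy; rewrite xy in Kx; have : set0 y by rewrite -KL0.
  have [z [A [B [cz Ax By]]]] := hT x y xy.
  by exists z, A, B; split=> // _ ->.
by exists z, B, A; split=> //; [exact: cutC|exact: xA].
Qed.

(** * Connected neighbourhoods and non-endpoints *)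

(** Finitely many sets [A]|[[set z]], coming from cuts with [x] in [A], intersect in a neighbourhood
    of [x] that avoids the compact complement of the interior of [U]. *)
Lemma connected_nbhs {T : topologicalType} {x : T} {U : set T} :
  @cut_points T -> connected [set: T] -> compact [set: T] -> nbhs x U ->
  exists C, [/\ nbhs x C, connected C & C `<=` U].
Proof.
move=> hT cT kT Ux.
(* Asking for connected traces on every connected [Y] through [x], not just for [C] connected, makes
   the property pass to intersections. The case [Y = setT] is the one needed at the end. *)
pose P X := exists C, [/\ nbhs x C, C `&` X = set0 &
  forall Y, connected Y -> Y x -> connected (Y `&` C)].
have [C [Cx CU cC]] : P (~` U°).
  apply: compact_ideal.
  - apply: (subclosed_compact _ kT) => //.
    by apply: open_closedC; exact: open_interior.
  - by exists setT; split; [exact: filterT|rewrite setI0|move=> Y; rewrite setIT].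
  - move=> X Y XY [C [Cx CY cC]]; exists C; split=> //.
    by rewrite -subset0 -CY; exact: setIS.
  - move=> X Y [C [Cx CX cC]] [C' [C'x CY cC']]; exists (C `&` C'); split.
    + exact: filterI.
    + rewrite -subset0 => t [[Ct C't] [Xt|Yt]].
        by have : set0 t by rewrite -CX.
      by have : set0 t by rewrite -CY.
    + move=> Z cZ Zx; rewrite setIA; apply: cC'; first exact: cC.
      by split=> //; exact: nbhs_singleton Cx.
  - move=> y nUy; have xy : x <> y by move=> xy; rewrite -xy in nUy.
    have [z [A [B [cz Ax By]]]] := hT x y xy.
    have [oA oB _ _] := cz.
    exists B; first exact: open_nbhs_nbhs.
    exists (A `|` [set z]); split.
    + by apply: (filterS (@subsetUl _ A _)); exact: open_nbhs_nbhs.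
    + rewrite -subset0 => t [[At|tz] Bt]; first exact: (cut_disj t cz).
      exact: (cut_neql t (cutC _ _ _ cz) Bt).
    + by move=> Y cY Yx; exact: (connected_setI_cut x cz cY Yx Ax).
exists C; split=> //.
  by rewrite -[C]setTI; exact: cC.
move=> y Cy; apply: interior_subset; apply: contrapT => nUy.
by have : set0 y by rewrite -CU.
Qed.

(** Were the complement of [q] connected, [cut_compact] would cut [q] from the outside of any
    neighbourhood [U] by one point [z]. The side of [q] would be an open set inside [U] with
    boundary [[set z]], making [q] an endpoint. *)
Lemma cut_nonendpoint {T : topologicalType} {q : T} :
  @cut_points T -> closed [set q] -> connected [set: T] -> compact [set: T] ->
  ~` [set q] !=set0 -> ~ endpoint q ->
  exists A B, [/\ cut q A B, A !=set0 & B !=set0].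
Proof.
move=> hT cq cT kT q0 nend.
have [cM|] := pselect (connected (~` [set q])); last first.
  move/connectedPn => [E [E0 defE sepE]].
  by exists (E false), (E true); split=> //; exact: separated_cut.
case: nend => U Uq.
have [| | |y qy|z [A [B [cz qA UB]]]] := @cut_compact _ [set q] _ (~` U°) cT _ cM q0.
- by exists q.
- move=> y /= yq; have [|z [A [B [cz Aq By]]]] := hT q y; first by move=> /esym.
  by exists z, A, B; split=> // _ ->.
- apply: (subclosed_compact _ kT) => //.
  by apply: open_closedC; exact: open_interior.
- by move=> /= yq; rewrite yq in qy.
have [oA oB AB0 ABz] := cz.
have Aq : A q by exact: qA.
exists A; split=> //.
  move=> y Ay; apply: interior_subset; apply: contrapT => /UB By.
  exact: (cut_disj y cz).
exists z; apply/seteqP; split=> y; rewrite /topological_boundary.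
  move=> [cAy nAy]; apply: contrapT => yz.
  have [Ay|By] := cut_memP y cz yz.
    by apply: nAy; exact: open_nbhs_nbhs.
  have : set0 y by rewrite -(cut_separated cz).1.
  by [].
move=> ->; split; last by move=> /interior_subset/(cut_neql z cz).
apply: contrapT => nAz.
(* With [z] outside its closure, [A] would be open, closed and nonempty. *)
have AT : A = setT.
  apply: cT; [by exists q|by exists A; rewrite ?setTI|].
  exists A; rewrite ?setTI// => t cAt.
  have [tz|tz] := pselect (t = z); first by rewrite tz in cAt.
  have [//|Bt] := cut_memP t cz tz.
  have : set0 t by rewrite -(cut_separated cz).1.
  by [].
have : A z by rewrite AT.
by move/(cut_neql z cz).
Qed.

(** * Finite and cyclic families of continua *)

(* Among all cuts having a member of the family on one side, take one with the
   fewest: two disjoint neighbours of such a member would be separated by a point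
   of it, giving a cut with fewer. *)
Lemma simplicial_continuum {T : topologicalType} {I : finType} {K : I -> set T}
    {z : T} {A B : set T} (i : I) :
  @cut_points T -> connected [set: T] ->
  (forall i, [/\ connected (K i), compact (K i) & K i !=set0]) ->
  cut z A B -> K i `<=` B ->
  exists i, forall j k, K i `&` K j !=set0 -> K i `&` K k !=set0 ->
    K j `&` K k !=set0.
Proof.
move=> hT cT hK.
pose P (B : set T) := [set i : I | `[< K i `<=` B >]]%SET.
have [n] := ubnP #|P B|; elim: n => // n IH in z A B i *.
rewrite ltnS => Bn cz KiB.
have [|/existsNP[j /existsNP[k]]] :=
  pselect (forall j k, K i `&` K j !=set0 -> K i `&` K k !=set0 ->
    K j `&` K k !=set0); first by exists i.
move=> /not_implyP[[x [Kix Kjx]] /not_implyP[[y [Kiy Kky]] nKjk]].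
have Kjk0 : K j `&` K k = set0.
  by rewrite -subset0 => t tjk; apply: nKjk; exists t.
have [cKi kKi Ki0] := hK i.
have [cKj kKj Kj0] := hK j; have [cKk kKk Kk0] := hK k.
have [z' [A' [B' [cz' KjA' KkB']]]] :=
  cut_disjoint_continua hT cT cKj kKj Kj0 cKk kKk Kk0 Kjk0.
(* [K i] is connected and has points on both sides of the cut at [z']. *)
have Kiz' : K i z'.
  apply: contrapT => nKz'; have [KA|KB] := connected_notin_cut cz' cKi nKz'.
    exact: (cut_disj y cz' (KA _ Kiy) (KkB' _ Kky)).
  exact: (cut_disj x cz' (KjA' _ Kjx) (KB _ Kix)).
have Bz' : B z' by exact: KiB.
have nz' : ~ (A `|` [set z]) z'.
  move=> [Az'|]; first exact: (cut_disj z' cz Az' Bz').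
  exact: (cut_neql z' (cutC _ _ _ cz) Bz').
(* The connected set [A]|[[set z]] misses [z'], so it lies on one side; exchanging [j] and [k] makes
   that side [A']. *)
wlog zA' : A' B' j k x y Kjx Kky KjA' KkB' cz' {nKjk Kjk0 cKj kKj Kj0 cKk kKk Kk0 Kix Kiy} / (A `|` [set z]) `<=` A'.
  move=> wl; have [sub|sub] := connected_notin_cut cz' (cut_side_connected cT cz) nz'.
    exact: (wl A' B' j k x y).
  exact: (wl B' A' k j y x _ _ _ _ (cutC _ _ _ cz')).
have BB : B' `<=` B.
  move=> t B't; have [tz|tz] := pselect (t = z).
    by case: (cut_disj t cz' _ B't); apply: zA'; right.
  have [At|//] := cut_memP t cz tz.
  by case: (cut_disj t cz' _ B't); apply: zA'; left.
(* The new cut still has [K k] inside [B'], but it loses [K i], which contains [z']. *)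
apply: (IH z' A' B' k) => //; apply: leq_trans Bn; apply: proper_card.
apply/properP; split.
  apply/fintype.subsetP => l; rewrite !finset.inE => /asboolP KlB'; apply/asboolP.
  by move=> t /KlB'/BB.
exists i; rewrite finset.inE; first exact/asboolP.
by apply/asboolP => /(_ _ Kiz')/(cut_neql z' (cutC _ _ _ cz')).
Qed.

(** The indexing models the successive images of a continuum whose [N]-th image returns into it. The
    cut only serves to produce one member [i0] whose neighbours pairwise meet; rotation transfers
    this to all indices. *)
Lemma cyclic_continua_meet {T : topologicalType} {K : nat -> set T} {N : nat}
    {z : T} {A B : set T} (i : nat) :
  @cut_points T -> hausdorff_space T -> connected [set: T] ->
  (forall i, [/\ connected (K i), compact (K i) & K i !=set0]) ->
  (forall i j, K i `&` K j !=set0 -> K i.+1 `&` K j.+1 !=set0) ->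
  (forall i, K i `<=` K (i %% N)%N) ->
  (forall x, exists2 i, (i < N)%N & K i x) ->
  cut z A B -> (i < N)%N -> K i `<=` B ->
  forall j k, (j < N)%N -> (k < N)%N -> K j `&` K k !=set0.
Proof.
move=> hT hausT cT hK shift1 per cov cz iN KiB.
have shift t j k : K j `&` K k !=set0 -> K (j + t)%N `&` K (k + t)%N !=set0.
  by elim: t => [|t IH]; rewrite ?addn0// !addnS => /IH; exact: shift1.
have red j k : K j `&` K k !=set0 -> K (j %% N)%N `&` K (k %% N)%N !=set0.
  by move=> [x [/per ? /per ?]]; exists x.
have N0 : (0 < N)%N by exact: leq_ltn_trans iN.
have [[i0 i0N] /= simp] := simplicial_continuum (K := fun i : 'I_N => K i)
  (Ordinal iN) hT cT (fun i => hK i) cz KiB.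
have {}simp j k : (j < N)%N -> (k < N)%N -> K i0 `&` K j !=set0 ->
    K i0 `&` K k !=set0 -> K j `&` K k !=set0.
  by move=> jN kN; exact: (simp (Ordinal jN) (Ordinal kN)).
have trans a j k : (a < N)%N -> (j < N)%N -> (k < N)%N ->
    K a `&` K j !=set0 -> K a `&` K k !=set0 -> K j `&` K k !=set0.
  move=> aN jN kN aj ak.
  (* Rotate by [t] to bring [a] to [i0]. *)
  have [t att] : exists t, ((a + t) %% N = i0)%N.
    by exists (i0 + (N - a))%N; rewrite addnCA subnKC ?(ltnW aN)// modnDr modn_small.
  have := simp ((j + t) %% N)%N ((k + t) %% N)%N (ltn_pmod _ N0) (ltn_pmod _ N0).
  rewrite -{1 2}att => /(_ (red _ _ (shift t _ _ aj)) (red _ _ (shift t _ _ ak))).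
  (* Meeting is only known to persist under forward shifts, so the rotation by [t] is undone by
     completing it to a multiple of [N]. *)
  move=> /(shift (N - t %% N)%N)/red; rewrite !modnDml -!addnA.
  have back l : (l < N)%N -> ((l + (t + (N - t %% N))) %% N = l)%N.
    move=> lN; rewrite {1}(divn_eq t N) -addnA subnKC ?(ltnW (ltn_pmod _ N0))//.
    by rewrite -mulSnr addnC modnMDl modn_small.
  by rewrite !back.
have clK l : closed (K l) by have [_ + _] := hK l; exact: compact_closed.
(* [W] and [W'] are closed and cover the space; transitivity of meeting makes them disjoint, so
   connectedness leaves only [W]. *)
pose W := \bigcup_(j in [set j | (j < N)%N /\ (K 0 `&` K j !=set0)]) K j.
pose W' := \bigcup_(j in [set j | (j < N)%N /\ ~ (K 0 `&` K j !=set0)]) K j.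
have fin P : finite_set [set j | (j < N)%N /\ P j].
  by apply: sub_finite_set (finite_II N) => j [].
have cW : closed W by exact: closed_bigcup.
have cW' : closed W' by exact: closed_bigcup.
have WW' : W = ~` W'.
  apply/seteqP; split=> x.
    move=> [j [jN j0] Kjx] [k [kN k0] Kkx]; apply: k0.
    apply: (trans j) => //; last by exists x.
    by rewrite setIC.
  move=> nW'x; have [j jN Kjx] := cov x; exists j => //; split=> //.
  by apply: contrapT => j0; apply: nW'x; exists j.
have WT : W = setT.
  apply: cT.
  - have [_ _ [x Kx]] := hK 0; exists x; exists 0; last by [].
    by split=> //; exists x.
  - by exists W; rewrite ?setTI// WW'; exact: closed_openC.
  - by exists W; rewrite ?setTI.
have all0 j : (j < N)%N -> K 0 `&` K j !=set0.
  move=> jN; apply: contrapT => j0; have [_ _ [x Kjx]] := hK j.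
  have : W x by rewrite WT.
  by rewrite WW'; apply; exists j.
by move=> j k jN kN; apply: (trans 0) => //; exact: all0.
Qed.

(** * Regular periodic decompositions and dense orbits *)

Lemma dense_bigcap_setC_nowhere_dense {T : topologicalType} {I : Type} (s : seq I)
    (F : I -> set T) :
  (forall i, closed (F i)) -> (forall i, nowhere_dense (F i)) ->
  open (\big[setI/setT]_(i <- s) ~` F i) /\ dense (\big[setI/setT]_(i <- s) ~` F i).
Proof.
move=> clF ndF; elim: s => [|i s [os ds]].
  rewrite big_nil; split; first exact: openT.
  by move=> O O0 _; rewrite setIT.
rewrite big_cons; have oi : open (~` F i) by exact: closed_openC.
split; [exact: openI|apply: denseI => // O [x Ox] oO].
apply: contrapT => OF; have : set0 x; last by [].
rewrite -(ndF i) -(closure_id (F i)).1//.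
apply: filterS (open_nbhs_nbhs (conj oO Ox)) => y Oy.
by apply: contrapT => nFy; apply: OF; exists y.
Qed.

Lemma val_iter_ordS {m : nat} (i : 'I_m) (n : nat) :
  val (iter n (@ordS m) i) = ((i + n) %% m)%N.
Proof.
elim: n => [|n IH]; first by rewrite addn0 modn_small.
by rewrite iterS /= -/(val _) IH -addn1 modnDml addn1 addnS.
Qed.

Lemma iter_ordS_id {m : nat} {i : 'I_m} {n : nat} :
  iter n (@ordS m) i = i -> (m %| n)%N.
Proof.
move=> /(congr1 val); rewrite val_iter_ordS /= => e.
have : (i + n == i + 0 %[mod m])%N by rewrite addn0 e modn_small.
by rewrite eqn_modDl mod0n.
Qed.

Lemma rpd_iter {T : topologicalType} {f : T -> T} {m : nat} {C : 'I_m -> set T}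
    {i : 'I_m} {x : T} (n : nat) :
  regular_periodic_decomposition f C -> C i x -> C (iter n (@ordS m) i) (iter n f x).
Proof.
move=> [_ _ fC _] Cx; elim: n => //= n IH.
by rewrite -fC; exists (iter n f x).
Qed.

Lemma rpd_closed {T : topologicalType} {f : T -> T} {m : nat} {C : 'I_m -> set T}
    (i : 'I_m) :
  regular_periodic_decomposition f C -> closed (C i).
Proof. by move=> [_ /(_ i) <- _ _]; exact: closed_closure. Qed.

(** If [q] lay in two pieces, each iterate of [q] would lie in the overlap of their shifts, which
    stay distinct. The whole orbit would be confined to finitely many closed nowhere dense sets,
    against its density. *)
Lemma rpd_dense_orbit_inj {T : topologicalType} {f : T -> T} {m : nat}
    {C : 'I_m -> set T} {q : T} {i j : 'I_m} :
  regular_periodic_decomposition f C -> dense (forward_orbit f q) ->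
  C i q -> C j q -> i = j.
Proof.
move=> rpd dq Ciq Cjq; apply: contrapT => ij.
pose it n := iter n (@ordS m).
have itmod n l : it n l = it (n %% m)%N l.
  by apply: val_inj; rewrite /it !val_iter_ordS modnDmr.
have it_inj n : injective (it n).
  by elim: n => // n IH x y /= /ordS_inj/IH.
pose F (k : 'I_m) := C (it k i) `&` C (it k j).
have clF k : closed (F k) by apply: closedI; exact: (rpd_closed _ rpd).
have ndF k : nowhere_dense (F k).
  by case: (rpd) => _ _ _; apply; move=> /it_inj.
have [oG dG] := dense_bigcap_setC_nowhere_dense (index_enum 'I_m) F clF ndF.
have [|x [_ Gx]] := dG setT _ openT; first by exists q.
have [|y [Gy [n _ ny]]] := dq _ _ oG; first by exists x.
have m0 : (0 < m)%N by exact: leq_ltn_trans (ltn_ord i).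
pose k := Ordinal (ltn_pmod n m0).
have : F k y.
  by rewrite -ny; split; rewrite /= -itmod; exact: (rpd_iter n rpd).
by move: Gy; rewrite (bigD1 k)//= => -[].
Qed.

Lemma rpd_unique_nbhs {T : topologicalType} {f : T -> T} {m : nat}
    {C : 'I_m -> set T} {q : T} {i : 'I_m} :
  regular_periodic_decomposition f C -> (forall j, C j q -> j = i) ->
  exists U, [/\ open U, U q & forall x j, U x -> C j x -> j = i].
Proof.
move=> rpd uq; exists (~` \bigcup_(j in [set j | j <> i]) C j); split.
- apply: closed_openC; apply: closed_bigcup => [|j _]; last exact: (rpd_closed _ rpd).
  exact: finite_finset.
- by move=> [j ji /uq].
- by move=> x j nx Cjx; apply: contrapT => ji; apply: nx; exists j.
Qed.

(* [K] is the component of the piece containing [q]; its images cover the space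
   because a dense orbit starts in it. *)
Lemma rpd_connected_cycle {T : topologicalType} {f : T -> T} {m : nat}
    {C : 'I_m -> set T} {q : T} :
  @cut_points T -> hausdorff_space T -> connected [set: T] -> compact [set: T] ->
  continuous f -> transitive_map f -> dense (forward_orbit f q) ->
  regular_periodic_decomposition f C ->
  exists (i : 'I_m) (K : set T) (N : nat),
    [/\ [/\ connected K, compact K, K q & (0 < N)%N /\ (m %| N)%N],
        K `<=` C i, forall j, C j q -> j = i,
        iter N f @` K `<=` K &
        forall x, exists2 n, (n < N)%N & (iter n f @` K) x].
Proof.
move=> hT hausT cT kT cf tf dq rpd.
have [i Ciq] : exists i, C i q.
  have [covC _ _ _] := rpd; have : [set: T] q by [].
  by rewrite -covC => -[i _ Ciq]; exists i.
have uq j : C j q -> j = i.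
  by move=> Cjq; exact: (rpd_dense_orbit_inj rpd dq Cjq Ciq).
have [U [oU Uq UC]] := rpd_unique_nbhs rpd uq.
have UCi : U `<=` C i.
  move=> x Ux; have [covC _ _ _] := rpd; have : [set: T] x by [].
  by rewrite -covC => -[j _ Cjx]; rewrite -(UC x j Ux Cjx).
pose K := connected_component (C i) q.
have cK : connected K by exact: component_connected.
have KC : K `<=` C i by exact: connected_component_sub.
have clK : closed K by apply: component_closed; exact: (rpd_closed _ rpd).
have kK : compact K by exact: (subclosed_compact clK kT).
have Kq : K q by exact: connected_component_refl.
have [Q [Qq cQ QU]] := connected_nbhs hT cT kT (open_nbhs_nbhs (conj oU Uq)).
have QK : Q `<=` K.
  apply: connected_component_max => //; first exact: nbhs_singleton.
  by move=> x /QU/UCi.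
have QQ : Q° `<=` Q by exact: interior_subset.
have oQ : open Q° by exact: open_interior.
have Q0 : Q° !=set0 by exists q.
(* Transitivity gives a return time [N] of [Q°] to itself. The point [y] lies in no piece but [C i],
   so [m] divides [N]. *)
have [N N0 [y [[x Qx xy] Qy]]] := tf Q° Q° oQ oQ Q0 Q0.
have iN : iter N (@ordS m) i = i.
  apply: (UC y); first exact/QU/QQ.
  by rewrite -xy; apply: (rpd_iter N rpd); exact/KC/QK/QQ.
have cfn n : continuous (iter n f).
  elim: n => [|n IH]; first by move=> t; exact: cvg_id.
  by move=> t; apply: continuous_comp; [exact: IH|exact: cf].
have NK : iter N f @` K `<=` K.
  (* The image is connected, lies in [C i] and contains [y]; since [y] is in [K], its component is
     [K] as well. *)
  rewrite [X in _ `<=` X](same_connected_component (y := y)); last exact/QK/QQ.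
  apply: connected_component_max.
  - by exists x => //; exact/QK/QQ.
  - by move=> _ [t Kt <-]; rewrite -iN; apply: (rpd_iter N rpd); exact: KC.
  - by apply: connected_continuous_connected => //; exact: continuous_subspaceT.
exists i, K, N; split=> //.
  by split=> //; split=> //; exact: iter_ordS_id iN.
pose W := \bigcup_(n in [set n | (n < N)%N]) (iter n f @` K).
have clW : closed W.
  apply: closed_bigcup => [|n _]; first exact: finite_II.
  apply: compact_closed => //; apply: continuous_compact => //.
  exact: continuous_subspaceT.
have KfN l x0 : K x0 -> K (iter (l * N) f x0).
  elim: l => // l IH Kx0; rewrite mulSn iterD.
  by apply: NK; exists (iter (l * N) f x0) => //; exact: IH.
(* An uncovered [t] would make the complement of [W] a nonempty open set, visited by some iterate
   [n] of [q]; but that iterate lies in the image of [K] of index [n %% N]. *)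
move=> t; apply: contrapT => nt.
have [|s [nWs [n _ ns]]] := dq (~` W) _ (closed_openC clW).
  by exists t => -[n nN Kt]; apply: nt; exists n.
apply: nWs; exists (n %% N)%N; first exact: ltn_pmod.
exists (iter (n %/ N * N) f q); first exact: KfN.
by rewrite -iterD addnC -divn_eq.
Qed.

(** * The bound on the length *)

Lemma rpd_length_le {T : topologicalType} {f : T -> T} {m : nat}
    {C : 'I_m -> set T} {q : T} {A B : set T} {a b : nat} :
  @cut_points T -> hausdorff_space T -> connected [set: T] -> compact [set: T] ->
  continuous f -> transitive_map f -> dense (forward_orbit f q) ->
  cut q A B -> A (iter a f q) -> B (iter b f q) ->
  regular_periodic_decomposition f C -> (m <= maxn a b)%N.
Proof.
move=> hT hausT cT kT cf tf dq cq Aa Bb rpd.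
have [i [K [N [[cK kK Kq [N0 mN]] KC uq NK cov]]]] :=
  rpd_connected_cycle hT hausT cT kT cf tf dq rpd.
rewrite leqNgt; apply/negP; rewrite gtn_max => /andP[am bm].
pose Kn n := iter n f @` K.
have KnS n : Kn n.+1 = f @` Kn n.
  by rewrite /Kn -image_comp.
have hK n : [/\ connected (Kn n), compact (Kn n) & Kn n !=set0].
  split; last by exists (iter n f q); exists q.
    elim: n => [|n IH]; first by rewrite /Kn image_id.
    by rewrite KnS; apply: connected_continuous_connected => //; exact: continuous_subspaceT.
  elim: n => [|n IH]; first by rewrite /Kn image_id.
  by rewrite KnS; apply: continuous_compact => //; exact: continuous_subspaceT.
(* Such an image lies in the piece [n] steps after [C i], and [C i] is the only piece containing
   [q]. *)
have Knq n : (0 < n < m)%N -> ~ Kn n q.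
  move=> /andP[n0 nm] [x Kx xq].
  have : C (iter n (@ordS m) i) q by rewrite -xq; apply: (rpd_iter n rpd); exact: KC.
  move=> /uq/iter_ordS_id/(dvdn_leq n0); by rewrite leqNgt nm.
(* The visiting times are positive because [q] itself lies on neither side. *)
have a0 : (0 < a)%N by case: a Aa {am} => // /(cut_neql q cq).
have b0 : (0 < b)%N by case: b Bb {bm} => // /(cut_neql q (cutC _ _ _ cq)).
have KaA : Kn a `<=` A.
  have [cKa _ _] := hK a.
  apply: (connected_sub_cutl (iter a f q) cq cKa) => //; last by exists q.
  by apply: Knq; rewrite a0.
have KbB : Kn b `<=` B.
  have [cKb _ _] := hK b.
  apply: (connected_sub_cutl (iter b f q) (cutC _ _ _ cq) cKb) => //; last by exists q.
  by apply: Knq; rewrite b0.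
have mN' : (m <= N)%N by exact: dvdn_leq.
have [||x [/KaA Ax /KbB Bx]] := cyclic_continua_meet (K := Kn) (N := N) b hT hausT cT hK
   _ _ cov cq (leq_trans bm mN') KbB a b (leq_trans am mN') (leq_trans bm mN').
- move=> j k [_ [[x Kx <-] [y Ky yx]]]; exists (f (iter j f x)); split.
    by exists x.
  by exists y => //=; rewrite yx.
- move=> j _ [x Kx <-]; exists (iter (j %/ N * N) f x); last first.
    by rewrite -iterD addnC -divn_eq.
  elim: (j %/ N)%N => // l IH; rewrite mulSn iterD.
  by apply: NK; exists (iter (l * N) f x).
- exact: (cut_disj x cq Ax Bx).
Qed.

(** * Existence of a longest decomposition *)

(** The complement of the image is open by compactness. If nonempty, it would be reached from the
    whole space by some [iter n f] with [n > 0], whose values lie in the image. *)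
Lemma transitive_surjective {T : topologicalType} {f : T -> T} :
  hausdorff_space T -> compact [set: T] -> continuous f -> transitive_map f ->
  f @` [set: T] = [set: T].
Proof.
move=> hausT kT cf tf; apply/seteqP; split=> // x _; apply: contrapT => nx.
have cl : closed (f @` setT).
  apply: compact_closed => //; apply: continuous_compact => //.
  exact: continuous_subspaceT.
have [||[//|n] _ [_ [[y _ <-]]]] := tf setT (~` (f @` setT)) openT (closed_openC cl).
- by exists x.
- by exists x.
- by apply; exists (iter n f y).
Qed.

Lemma rpd_trivial {T : topologicalType} {f : T -> T} :
  f @` [set: T] = [set: T] ->
  regular_periodic_decomposition f (fun _ : 'I_1 => [set: T]).
Proof.
move=> fT; split=> //.
- by apply/seteqP; split=> // x _; exists ord0.
- by move=> _; rewrite /regclosed interiorT closureT.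
- by move=> i j; rewrite !ord1.
Qed.

Lemma rpd_nonempty {T : topologicalType} {f : T -> T} {m : nat} {C : 'I_m -> set T}
    (x : T) (i : 'I_m) :
  regular_periodic_decomposition f C -> C i !=set0.
Proof.
move=> rpd; have [j Cjx] : exists j, C j x.
  have [covC _ _ _] := rpd; have : [set: T] x by [].
  by rewrite -covC => -[j _ Cjx]; exists j.
(* Moving forward [m - j] steps brings index [j] to 0, and [i] more bring it to [i]. *)
have <- : iter (m - j + i) (@ordS m) j = i.
  apply: val_inj; rewrite val_iter_ordS addnA subnKC ?(ltnW (ltn_ord j))//.
  by rewrite modnDl modn_small.
by exists (iter (m - j + i) f x); exact: (rpd_iter _ rpd).
Qed.

Lemma dendrite_cut_points {R : realType} {D : metricType R} :
  dendrite D -> @cut_points D.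
Proof.
move=> [_ sepD] x y /sepD[z [A [B [zAB sAB Ax By]]]]; exists z, A, B; split=> //.
apply: separated_cut => //.
by apply/accessible_closed_set1/hausdorff_accessible/metric_hausdorff.
Qed.

Theorem corollary4p4 (R : realType) (D : metricType R) (f : D -> D)
    (hD : dendrite D) (hcont : continuous f) (htrans : transitive_map f)
    (hq : exists2 q : D,
        ([set: D] `\` Endpoints D) q & dense (forward_orbit f q)) :
  exists (m : nat) (C : 'I_m -> set D), terminal_decomposition f C.
Proof.
have hT := dendrite_cut_points hD.
have [[_ kT cT] _] := hD.
have hausT : hausdorff_space D by exact: metric_hausdorff.
have [q [_ nend] dq] := hq.
have cq : closed [set q].
  exact/accessible_closed_set1/hausdorff_accessible.
pose P m := `[< exists C : 'I_m -> set D, regular_periodic_decomposition f C >].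
have P1 : P 1%N.
  apply/asboolP; eexists; apply: rpd_trivial.
  exact: transitive_surjective.
(* Length 1 occurs, so a bound on the lengths yields a largest one. *)
suff [M PM] : exists M, forall m, P m -> (m <= M)%N.
  have [m /asboolP[C rpd] max] := ex_maxnP (ex_intro _ 1%N P1) PM.
  exists m, C; split=> // k C' rpd'; apply: max; apply/asboolP.
  by exists C'.
have [q0|q0] := pselect (~` [set q] !=set0).
  have [A [B [cqAB A0 B0]]] := cut_nonendpoint hT cq cT kT q0 nend.
  have [oA oB _ _] := cqAB.
  have [x [Aa [a _ ax]]] := dq _ A0 oA.
  have [y [Bb [b _ bx]]] := dq _ B0 oB.
  rewrite -ax in Aa; rewrite -bx in Bb.
  exists (maxn a b) => m /asboolP[C].
  exact: (rpd_length_le hT hausT cT kT hcont htrans dq cqAB Aa Bb).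
(* The one-point space is a genuine case: no open set has a one-point boundary there, so [q] is not
   an endpoint. Every piece then contains [q], which rules out two indices. *)
have allq x : x = q.
  by apply: contrapT => xq; apply: q0; exists x.
exists 1%N => m /asboolP[C rpd]; rewrite leqNgt; apply/negP => m1.
have Cq i : C i q.
  by have [x Cx] := rpd_nonempty q i rpd; rewrite -(allq x).
have := rpd_dense_orbit_inj rpd dq (Cq (Ordinal (ltnW m1))) (Cq (Ordinal m1)).
by move=> /(congr1 val).
Qed.
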